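(* Let $m,n,a$ be positive integers with $m\ge 4$. The number of standard Young tableaux of battery shape $[(m^n),a,4]$ is equal to $$f^{(m^n)}\;{}_{[3,5,7]}F_{[2,4,6]}\left[\begin{array}{l|l|l} a,\ m,\ -n & -mn,\ 1 & 1\\ a+t,\ m-1,\ -n-1,\ -t,\ -t & -mn+t,\ -t-1,\ -t-1,\ 1 & 1\\ a+t+v,\ m-2,\ -n-2,\ -t-1,\ -t-1,\ -v,\ -v & -mn+t+v,\ -t-2,\ -t-2,\ -v-1,\ -v-1,\ 1 & 1\end{array}\right],$$ where $t,v$ denote the first two summation indices; that is, it is equal to $$f^{(m^n)}\sum_{t=0}^{n}\sum_{v=0}^{t}\sum_{w=0}^{v}\frac{(a)_t(m)_t(-n)_t}{(-mn)_t(1)_t\,t!}\cdot\frac{(a+t)_v(m-1)_v(-n-1)_v(-t)_v^2}{(-mn+t)_v(-t-1)_v^2(1)_v\,v!}\cdot\frac{(a+t+v)_w(m-2)_w(-n-2)_w(-t-1)_w^2(-v)_w^2}{(-mn+t+v)_w(-t-2)_w^2(-v-1)_w^2(1)_w\,w!}.$$ Here $f^{(m^n)}$ is the number of standard Young tableaux of rectangular shape $(m^n)$.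
   Context: $(m^n)$ denotes the partition with $n$ parts all equal to $m$ (Young diagram with $n$ rows and $m$ columns; row 1 is the top row). For integers $a\ge 1$, $1\le k\le m$, the battery shape $[(m^n),a,k]$ (of size $mn+a$) is obtained from the Young diagram of $(m^n)$ by adding a column of $a$ cells directly above the top cell of the $k$-th column; in coordinates it consists of the cells $(i,j)$ with $1\le i\le n$, $1\le j\le m$, together with the cells $(0,k),(-1,k),\dots,(1-a,k)$, where the first coordinate is the row (increasing downwards) and the second the column. A standard Young tableau of a shape with $M$ cells is a bijection from the set of cells to $\{1,\dots,M\}$ such that entries increase from left to right in each row and from top to bottom in each column (including the added cells). Pochhammer symbol: $(x)_0=1$, $(x)_s=x(x+1)\cdots(x+s-1)$ for $s\ge1$. Multiple hypergeometric function: for rows $i=0,\dots,N$ with upper parameters $a_{i,1},\dots,a_{i,x_i}$, lower parameters $b_{i,1},\dots,b_{i,y_i}$ and arguments $z_i$ (listed in row $i$ as upper $|$ lower $|$ argument), where $a_{i,j},b_{i,j}$ may depend on the summation indices $m_l$ with $l<i$, $${}_{[x_0,\dots,x_N]}F_{[y_0,\dots,y_N]}[\cdots]=\sum_{m_0\ge 0}\ \sum_{m_1=0}^{m_0}\cdots\sum_{m_N=0}^{m_{N-1}}\ \prod_{i=0}^{N}\frac{\prod_{j=1}^{x_i}(a_{i,j})_{m_i}}{\prod_{j=1}^{y_i}(b_{i,j})_{m_i}}\frac{z_i^{m_i}}{m_i!}.$$ When row $0$ contains an upper parameter $-p$ and a lower parameter $-q$ with integers $0\le p\le q$, the sum over $m_0$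 is truncated to $0\le m_0\le p$. In the claim the indices $m_0,m_1,m_2$ are called $t,v,w$. *)

(* Defs.v *)
From HB Require Import structures.
From mathcomp Require Import all_boot all_order all_algebra.
From mathcomp Require Import finmap.

Set Implicit Arguments.
Unset Strict Implicit.
Unset Printing Implicit Defensive.

Import Order.TTheory GRing.Theory Num.Theory.

Local Open Scope fset_scope.
Local Open Scope ring_scope.

(* A cell is a pair (row, column); row numbers increase downwards and may be
   nonpositive. *)
Definition cell : Type := (int * int)%type.

Definition rect (m n : nat) : {fset cell} :=
  [fset (i%:Z, j%:Z) | i in iota 1 n, j in iota 1 m].

(* The i-th added cell (0 <= i < a) lies in row -i of column k. *)
Definition battery (m n a k : nat) : {fset cell} :=
  rect m n `|` [fset (- i%:Z, k%:Z) | i in iota 0 a].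

(* The entry e of {1, ..., M} is encoded by the ordinal e - 1 of 'I_M. *)
Definition is_syt (D : {fset cell}) (T : {ffun D -> 'I_#|` D|}) : bool :=
  [&& injectiveb T,
      [forall e, exists c, T c == e],
      [forall c : D, forall d : D,
         ((val c).1 == (val d).1) && ((val c).2 < (val d).2) ==> (T c < T d)%N]
    & [forall c : D, forall d : D,
         ((val c).2 == (val d).2) && ((val c).1 < (val d).1) ==> (T c < T d)%N]].

Definition num_syt (D : {fset cell}) : nat :=
  #|[set T : {ffun D -> 'I_#|` D|} | is_syt T]|.

Definition poch (x : rat) (s : nat) : rat := \prod_(i < s) (x + (i : nat)%:R).

(* One row of parameters; the parameters of row i are functions of the sequence
   [:: m_0; ...; m_(i-1)] of the preceding summation indices. *)
Record hrow := HRow {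
  upper : seq nat -> seq rat;
  lower : seq nat -> seq rat;
  argument : rat
}.

Definition hterm (r : hrow) (ms : seq nat) (s : nat) : rat :=
  (\prod_(x <- upper r ms) poch x s) / (\prod_(y <- lower r ms) poch y s)
  * (argument r ^+ s / s`!%:R).

(* Iterated sum over rs, the indices ms of the preceding rows being fixed and
   the first remaining index ranging over 0, ..., p. *)
Fixpoint hsum (rs : seq hrow) (ms : seq nat) (p : nat) : rat :=
  if rs is r :: rs' then
    \sum_(0 <= s < p.+1) hterm r ms s * hsum rs' (rcons ms s) s
  else 1.

(* The terminating series: row 0 is meant to contain an upper parameter -p and
   a lower parameter -q with p <= q, so that m_0 ranges over 0, ..., p. *)
Definition multihyp (p : nat) (rs : seq hrow) : rat := hsum rs [::] p.

(* Main.v *)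
Require Import Defs.
From HB Require Import structures.
From mathcomp Require Import all_boot all_order perm all_algebra.
From mathcomp Require Import finmap.
From mathcomp Require Import zify ring lra.

Set Implicit Arguments.
Unset Strict Implicit.
Unset Printing Implicit Defensive.

Import Order.TTheory GRing.Theory Num.Theory.
Local Open Scope fset_scope.
Local Open Scope ring_scope.

(** Fill a battery tableau with 1, 2, 3, ... in turn. Until all added cells are
   filled, the top cell of column 4 is the next free cell of that column and
   blocks the columns on its right, so only the first three columns and the
   added cells receive entries. A stage of the process is therefore described
   by the numbers t >= v >= w of cells filled in columns 1, 2, 3 and by the
   number b of added cells still empty. Let G b t v w be the number of ways to
   complete such a stage. Choosing the place of the next entry gives
<<
   G (b+1) t v w = G b t v w + G (b+1) (t+1) v w + G (b+1) t (v+1) w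
                             + G (b+1) t v (w+1)
>>
   (state_count_rec). Let F t v w be the number of standard Young tableaux with
   columns of lengths t, v, w, which is additive in the opposite direction
   (three_col_count_rec). Summation by parts turns
   sum (d_s * F * G (b+1)), where s = t + v + w and d_s = c_s - c_(s-1), into
   sum (c_s * F * G b) (weighted_count_step). One starts with d_s = [s = 0], for
   which the sum is G a 0 0 0, the number wanted; a summations raise the
   coefficient to the binomial (a + s - 1 choose s), so that number is
   sum (binomial * F * G 0 t v w) (battery_count).

   The remaining G 0 t v w counts the tableaux of what is left of the rectangle,
   a shape with weakly increasing columns. For these a product formula of
   Frobenius type holds (frame_formula): with l_j = h_j + j, the count is
   (sum h_j)! / (prod l_j!) times the Vandermonde product of the l_j. It follows
   from removing one minimal cell at a time, because the determinant of the
   falling factorials l_i (l_i - 1) ... (l_i - j + 1) satisfies the matching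
   recursion (falling_det_step). Dividing by the formula for the full rectangle
   leaves only factors from the first three columns and their products with the
   others, which telescope to Pochhammer symbols (state_ratio). Each term of the
   sum is then the term of the hypergeometric series with the same indices
   (hyper_term). *)

(** * Tableaux as linear extensions *)

Definition prec (c d : cell) : bool :=
  (c.1 == d.1) && (c.2 < d.2) || (c.2 == d.2) && (c.1 < d.1).

Definition may_precede (c d : cell) : bool := ~~ prec d c.

(** A tableau is handled as the list of its cells in the order of their
   entries: removing the cell with the least entry is then taking the tail. *)
Definition linext (D : {fset cell}) : seq (seq cell) :=
  [seq s <- permutations (enum_fset D) | pairwise may_precede s].

Lemma mem_linext D s :
  (s \in linext D) = perm_eq s (enum_fset D) && pairwise may_precede s.
Proof. by rewrite mem_filter mem_permutations andbC. Qed.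

Lemma linext_uniq D : uniq (linext D).
Proof. by rewrite filter_uniq // permutations_uniq. Qed.

Lemma is_sytP (D : {fset cell}) (T : {ffun D -> 'I_#|` D|}) :
  reflect (injective T /\ forall c d : D, prec (val c) (val d) -> (T c < T d)%N)
          (is_syt T).
Proof.
apply: (iffP and4P) =>
  [[/injectiveP injT _ /'forall_forallP rowT /'forall_forallP colT]|[injT precT]].
  split=> // c d /orP[] H; first by have /implyP := rowT c d; exact.
  by have /implyP := colT c d; exact.
split; first exact/injectiveP.
- apply/forallP=> e; have [g _ gT] : bijective T.
    by apply: inj_card_bij => //; rewrite card_ord cardfE.
  by apply/existsP; exists (g e); rewrite gT.
- apply/'forall_forallP=> c d; apply/implyP=> H; apply: precT; by rewrite /prec H.
- apply/'forall_forallP=> c d; apply/implyP=> H; apply: precT; by rewrite /prec H orbT.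
Qed.


(** The entry of a cell is its position in the list. The rank of the cell in D
   is only a default value, for lists that do not enumerate D. *)
Definition tab_of_list (D : {fset cell}) (s : seq cell) : {ffun D -> 'I_#|` D|} :=
  [ffun c : D => insubd (cast_ord (esym (cardfE D)) (enum_rank c))
                    (index (val c) s)].

Lemma tab_of_listE (D : {fset cell}) s (c : D) :
  perm_eq s (enum_fset D) -> tab_of_list D s c = index (val c) s :> nat.
Proof.
move=> Ds; rewrite ffunE insubdK // unfold_in.
by rewrite -(perm_size Ds) index_mem (perm_mem Ds) (valP c).
Qed.

Lemma tab_of_list_syt D s : s \in linext D -> is_syt (tab_of_list D s).
Proof.
rewrite mem_linext => /andP[Ds prs].
have mems (c : D) : val c \in s by rewrite (perm_mem Ds) (valP c).
apply/is_sytP; split=> [c d Ecd|c d cd].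
  apply: val_inj; have /(congr1 val) /= := Ecd.
  by rewrite !tab_of_listE // => /(index_inj (0, 0) (mems c) (mems d)) ->.
rewrite !tab_of_listE // ltnNge leq_eqVlt; apply/norP; split.
  apply/eqP=> /(index_inj (0, 0) (mems d) (mems c)) Edc; move: cd.
  by rewrite Edc /prec !ltxx !andbF.
apply/negP=> lt_dc; have /(pairwiseP (val c)) := prs.
move/(_ (index (val d) s) (index (val c) s)).
rewrite !inE !index_mem => /(_ (mems d) (mems c) lt_dc).
by rewrite !nth_index // /may_precede cd.
Qed.

Lemma tab_of_list_inj D : {in linext D &, injective (tab_of_list D)}.
Proof.
move=> s s'; rewrite !mem_linext => /andP[Ds _] /andP[Ds' _] E.
have szs : size s = size s' by rewrite (perm_size Ds) (perm_size Ds').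
apply: (@eq_from_nth _ (0, 0)) => // i lti.
have us : uniq s by rewrite (perm_uniq Ds) fset_uniq.
have xD : nth (0, 0) s i \in D by rewrite -[_ \in D](perm_mem Ds) mem_nth.
have /(congr1 val) /= := congr1 (fun T : {ffun D -> 'I_#|` D|} => T [` xD]) E.
rewrite !tab_of_listE //= index_uniq // => Ei; rewrite [in RHS]Ei nth_index //.
by rewrite (perm_mem Ds').
Qed.

Lemma syt_tab_of_list (D : {fset cell}) (T : {ffun D -> 'I_#|` D|}) :
  is_syt T -> exists2 s, s \in linext D & T = tab_of_list D s.
Proof.
move=> /is_sytP[injT precT].
have [g gK Kg] : bijective T by apply: inj_card_bij => //; rewrite card_ord cardfE.
have inj_vg : injective (val \o g) by apply: inj_comp; [exact: val_inj | exact: can_inj Kg].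
pose s := [seq (val \o g) i | i <- enum 'I_#|` D|].
have Ds : perm_eq s (enum_fset D).
  apply: uniq_perm; rewrite ?fset_uniq //; first by rewrite map_inj_uniq ?enum_uniq.
  move=> x.
  apply/mapP/idP => [[i _ ->]|xD]; first exact: valP.
  by exists (T [` xD]); rewrite ?mem_enum //= gK.
exists s.
  rewrite mem_linext Ds pairwise_map.
  have: pairwise (relpre val ltn) (enum 'I_#|` D|).
    rewrite -(pairwise_map val) val_enum_ord -sorted_pairwise ?iota_ltn_sorted //.
    exact: ltn_trans.
  apply: sub_pairwise => i j /= lt_ij; apply/negP=> /precT.
  by rewrite !Kg ltnNge ltnW.
apply/ffunP=> c; apply: val_inj; rewrite /= tab_of_listE //.
by rewrite -[in RHS](gK c) (index_map inj_vg (enum _) (T c)) index_enum_ord.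
Qed.

Lemma num_sytE (D : {fset cell}) : num_syt D = size (linext D).
Proof.
rewrite /num_syt -(size_map (tab_of_list D)) cardsE cardE; apply: perm_size.
apply: uniq_perm; rewrite ?enum_uniq //.
  by rewrite map_inj_in_uniq ?linext_uniq //; apply: tab_of_list_inj.
move=> T; rewrite mem_enum unfold_in /=; apply/idP/mapP.
  by case/syt_tab_of_list=> s; exists s.
by case=> s sD ->; apply: tab_of_list_syt.
Qed.

Definition minimal_in (D : {fset cell}) (x : cell) : bool :=
  (x \in D) && all (may_precede x) (enum_fset D).

(** The least entry sits in a minimal cell, and what remains is a tableau of
   the remaining cells: the first step of a linear extension. *)
Lemma num_syt_rec (D : {fset cell}) : (0 < #|` D|)%N ->
  num_syt D = (\sum_(x <- enum_fset D | minimal_in D x) num_syt (D `\ x)%fset)%N.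
Proof.
move=> Dpos; rewrite num_sytE.
pose L := [seq x :: s | x <- [seq x <- enum_fset D | minimal_in D x],
                       s <- linext (D `\ x)%fset].
have -> : size (linext D) = size L.
  apply: perm_size; apply: uniq_perm; first exact: linext_uniq.
    apply: allpairs_uniq_dep; first by rewrite filter_uniq ?fset_uniq.
      by move=> x _; apply: linext_uniq.
    by move=> [x s] [y s'] _ _ /= [-> ->].
  have Dx x : x \in D -> perm_eq (enum_fset D) (x :: enum_fset (D `\ x)%fset).
    move=> xD; apply: uniq_perm; rewrite /= ?fset_uniq ?andbT //.
      by rewrite [_ \in _]in_fsetD1 eqxx.
    move=> y; rewrite inE [y \in enum_fset (_ `\ _)%fset]in_fsetD1.
    by case: eqP => [->|].
  move=> s; rewrite mem_linext; apply/andP/allpairsPdep => [[Ds prs]|].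
    case: s Ds prs => [|x s] Ds /=.
      by move: Dpos; rewrite -(perm_size Ds).
    case/andP=> minx prs.
    have xD : x \in D by rewrite -[_ \in D](perm_mem Ds) mem_head.
    exists x, s; split=> //.
      rewrite mem_filter /minimal_in xD andbT -(perm_all _ Ds) /= minx andbT.
      by rewrite /may_precede /prec !ltxx !andbF.
    rewrite mem_linext prs andbT -(perm_cons x).
    by apply: perm_trans Ds _; apply: Dx.
  case=> x [s'] [xm]; rewrite mem_linext => /andP[Ds prs] ->.
  move: xm; rewrite mem_filter => /andP[/andP[xD minx] _]; split.
    by rewrite perm_sym; apply: perm_trans (Dx x xD) _; rewrite perm_cons perm_sym.
  rewrite /= prs andbT; apply/allP=> y; rewrite (perm_mem Ds) => yD.
  by apply: (allP minx); move: yD; rewrite [_ \in _]in_fsetD1 => /andP[].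
rewrite size_allpairs_dep sumnE big_map big_filter.
by apply: eq_bigr => x _; rewrite num_sytE.
Qed.

(** * Shapes made of columns standing on a common row *)

(** Cells are numbered from the bottom row n upwards, in columns numbered from
   0. All shapes of the proof consist of columns standing on row n, so that one
   height function describes rectangles, batteries and what remains of them
   when minimal cells are removed. *)
Definition col_cell (n j i : nat) : cell := (n%:Z - i%:Z, j.+1%:Z).

Definition col_shape (m n : nat) (h : nat -> nat) : {fset cell} :=
  [fset col_cell n j i | j in iota 0 m, i in iota 0 (h j)].

Lemma col_shapeP m n h x :
  reflect (exists j i, [/\ (j < m)%N, (i < h j)%N & x = col_cell n j i])
          (x \in col_shape m n h).
Proof.
apply: (iffP (imfset2P _ _ _ _ _)) => [[j jm [i ih ->]]|[j [i [jm ih ->]]]].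
  by exists j, i; move: jm ih; rewrite /= !mem_iota.
by exists j; rewrite /= ?mem_iota //; exists i; rewrite //= mem_iota.
Qed.

Lemma col_cell_inj n j i j' i' :
  col_cell n j i = col_cell n j' i' -> j = j' /\ i = i'.
Proof. by case; lia. Qed.

Lemma mem_col_shape m n h j i :
  (col_cell n j i \in col_shape m n h) = (j < m)%N && (i < h j)%N.
Proof.
apply/col_shapeP/andP => [[j' [i' [jm ih /col_cell_inj[-> ->]]]] //|[jm ih]].
by exists j, i.
Qed.

Lemma eq_col_shape m n h h' :
  (forall j, (j < m)%N -> h j = h' j) -> col_shape m n h = col_shape m n h'.
Proof.
move=> Eh; apply/fsetP=> x; apply/col_shapeP/col_shapeP => -[j [i [jm ih ->]]];
  by exists j, i; rewrite ?Eh // -?Eh.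
Qed.

Lemma prec_col_cell n j i j' i' :
  prec (col_cell n j i) (col_cell n j' i')
  = (i == i') && (j < j')%N || (j == j') && (i' < i)%N.
Proof. rewrite /prec /=; lia. Qed.

Definition lower_col (h : nat -> nat) (j : nat) : nat -> nat :=
  fun k => if k == j then (h k).-1 else h k.

(** The top cell of column j is minimal when all columns on its left are too
   short to reach its row. *)
Definition removable (h : nat -> nat) (j : nat) : bool :=
  (0 < h j)%N && all (fun k => h k < h j)%N (iota 0 j).

Lemma removableP h j :
  reflect ((0 < h j)%N /\ forall k, (k < j)%N -> (h k < h j)%N) (removable h j).
Proof.
apply: (iffP andP) => -[h0 hk]; split=> //.
  by move=> k kj; apply: (allP hk); rewrite mem_iota.
by apply/allP=> k; rewrite mem_iota => /andP[_ kj]; apply: hk.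
Qed.

Lemma minimal_col_shape m n h j i :
  minimal_in (col_shape m n h) (col_cell n j i)
  = [&& (j < m)%N, removable h j & i == (h j).-1].
Proof.
apply/andP/and3P => [[]|[jm /removableP[h0 hk] /eqP->]].
  rewrite mem_col_shape => /andP[jm ih] /allP mini.
  have Ei : i = (h j).-1.
    apply/eqP; move: (mini (col_cell n j (h j).-1)).
    rewrite [_ \in _]mem_col_shape jm /may_precede prec_col_cell.
    lia.
  split=> //; last exact/eqP.
  apply/removableP; split=> [|k kj]; first lia.
  rewrite ltnNge; apply/negP=> hjk.
  have := mini (col_cell n k i).
  rewrite [_ \in _]mem_col_shape /may_precede prec_col_cell.
  lia.
rewrite mem_col_shape jm; split; first lia.
apply/allP=> x /col_shapeP[j' [i' [jm' ih' ->]]].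
rewrite /may_precede prec_col_cell; apply/negP=> /orP[/andP[/eqP Ei lt_jj]|/andP[/eqP Ej]].
  by have := hk _ lt_jj; lia.
by rewrite Ej in ih' *; lia.
Qed.

Lemma col_shapeD1 m n h j : (j < m)%N -> (0 < h j)%N ->
  col_shape m n h `\ col_cell n j (h j).-1 = col_shape m n (lower_col h j).
Proof.
move=> jm h0; apply/fsetP=> x; rewrite in_fsetD1; apply/andP/idP.
  case=> xne /col_shapeP[j' [i' [jm' ih' Ex]]]; subst x.
  rewrite mem_col_shape jm' /lower_col; case: eqP => [Ej|//].
  subst j'.
  suff: i' <> (h j).-1 by lia.
  by move=> Ei; rewrite Ei eqxx in xne.
case/col_shapeP=> j' [i' [jm' ih' ->]]; rewrite mem_col_shape jm' /=.
move: ih'; rewrite /lower_col; case: eqP => [->|nej] ih'.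
  split; last lia.
  by apply/eqP=> /col_cell_inj[_]; lia.
by split=> //; apply/eqP=> /col_cell_inj[].
Qed.

(** Specialization of num_syt_rec: minimal cells are tops of removable columns,
   and removing one lowers that column. *)
Lemma num_syt_col_shape m n (h : nat -> nat) : (0 < \sum_(j < m) h j)%N ->
  num_syt (col_shape m n h)
  = (\sum_(j < m | removable h j) num_syt (col_shape m n (lower_col h j)))%N.
Proof.
rewrite lt0n sum_nat_eq0 negb_forall => /existsP[j0 /= hj0].
rewrite num_syt_rec; last first.
  rewrite cardfs_gt0; apply/fset0Pn; exists (col_cell n j0 0).
  by rewrite mem_col_shape ltn_ord lt0n.
rewrite -big_filter.
rewrite (perm_big [seq col_cell n j (h j).-1 | j <- [seq j <- iota 0 m | removable h j]]).
  rewrite big_map big_filter.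
  rewrite -(big_mkord (removable h) (fun j => num_syt (col_shape m n (lower_col h j)))).
  rewrite /index_iota subn0 big_seq_cond [RHS]big_seq_cond; apply: eq_bigr => j.
  rewrite mem_iota => /andP[/andP[_ jm] /removableP[hj _]].
  by rewrite col_shapeD1.
apply: uniq_perm; first by rewrite filter_uniq ?fset_uniq.
  by rewrite map_inj_uniq ?filter_uniq ?iota_uniq // => i j /col_cell_inj[].
move=> x; rewrite mem_filter; apply/andP/mapP.
  case=> minx /col_shapeP[j [i [jm ih Ex]]]; subst x.
  move: minx; rewrite minimal_col_shape => /and3P[_ rj /eqP->].
  by exists j; rewrite // mem_filter rj mem_iota.
case=> j; rewrite mem_filter mem_iota => /andP[rj jm] ->.
have hj : (0 < h j)%N by case/removableP: rj.
rewrite minimal_col_shape rj eqxx !andbT; split; first lia.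
by rewrite [_ \in _]mem_col_shape; lia.
Qed.

Lemma num_syt_fset0 : num_syt fset0 = 1%N.
Proof.
rewrite num_sytE /linext.
have -> : enum_fset (fset0 : {fset cell}) = [::].
  by apply: size0nil; apply: cardfs0.
by [].
Qed.

Lemma rect_col_shape m n : rect m n = col_shape m n (fun=> n).
Proof.
apply/fsetP=> x; apply/imfset2P/col_shapeP.
  case=> i /= i_in [j /= j_in ->]; move: i_in j_in; rewrite !mem_iota => i_in j_in.
  exists j.-1, (n - i)%N; rewrite /col_cell; split; try lia.
  congr pair; lia.
case=> j [i [jm ih ->]]; exists (n - i)%N; rewrite /= ?mem_iota; first lia.
exists j.+1; rewrite /= ?mem_iota; first lia.
rewrite /col_cell; congr pair; lia.
Qed.

Lemma battery_col_shape m n a k : (k < m)%N ->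
  battery m n a k.+1 = col_shape m n (fun j => if j == k then n + a else n)%N.
Proof.
move=> km; apply/fsetP=> x; rewrite in_fsetU rect_col_shape; apply/orP/col_shapeP.
  case=> [/col_shapeP[j [i [jm ih ->]]]|/imfsetP[i /= i_in ->]].
    by exists j, i; split=> //; case: eqP; lia.
  exists k, (n + i)%N; rewrite eqxx; move: i_in; rewrite mem_iota => i_in.
  split=> //; first lia.
  rewrite /col_cell; congr pair; lia.
case=> j [i [jm ih ->]].
case: (ltnP i n) => lt_in; first by left; rewrite mem_col_shape jm lt_in.
right; move: ih; case: eqP => [->|]; last lia.
move=> ih; apply/imfsetP; exists (i - n)%N; rewrite /= ?mem_iota; first lia.
rewrite /col_cell; congr pair; lia.
Qed.

(** * Product formula for shapes with increasing columns *)

(** In the Leibniz expansion, the term of a permutation s gets multiplied by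
   d (s i) when row i is scaled; the sum over i is the sum of all d. *)
Lemma sum_det_scale_row (R : comPzRingType) k (A : 'M[R]_k) (d : 'I_k -> R) :
  \sum_i \det (\matrix_(p, q) (if p == i then d q * A p q else A p q))
  = (\sum_q d q) * \det A.
Proof.
rewrite exchange_big mulr_sumr; apply: eq_bigr => /= s _.
rewrite -mulr_sumr mulrCA; congr (_ * _).
rewrite [X in _ = X * _](reindex_inj (@perm_inj _ s)) mulr_suml.
apply: eq_bigr => i _.
transitivity (\prod_p ((if p == i then d (s p) else 1) * A p (s p))).
  by apply: eq_bigr => p _; rewrite mxE; case: eqP; rewrite ?mul1r.
by rewrite big_split /= -big_mkcond big_pred1_eq.
Qed.

Definition falling_det (k : nat) (l : nat -> nat) : rat :=
  \det (\matrix_(i < k, j < k) ((l i) ^_ j)%:R : 'M[rat]_k).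

Lemma eq_falling_det k l l' :
  (forall i, (i < k)%N -> l i = l' i) -> falling_det k l = falling_det k l'.
Proof.
by move=> El; congr (\det _); apply/matrixP=> i j; rewrite !mxE El.
Qed.

Lemma falling_det_eq0 k l i j : (i < j < k)%N -> l i = l j -> falling_det k l = 0.
Proof.
case/andP=> ij jk Eij; have ik := ltn_trans ij jk.
apply: (@determinant_alternate _ _ _ (Ordinal ik) (Ordinal jk)).
  by rewrite -val_eqE /= ltn_eqF.
by move=> q; rewrite !mxE /= Eij.
Qed.

(** The relation x * (x - 1)^_j = (x - j) * x^_j splits row i of the left-hand
   side into l_i times the original row, minus that row with entry j multiplied
   by j. The first parts add up to the sum of the l_i; the second ones are
   evaluated by sum_det_scale_row. *)
Lemma falling_det_step k (l : nat -> nat) :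
  \sum_(i < k) (l i)%:R * falling_det k (lower_col l i)
  = (\sum_(i < k) (l i)%:R - \sum_(i < k) (i : nat)%:R) * falling_det k l.
Proof.
have Ff (x j : nat) : x%:R * (x.-1 ^_ j)%:R = (x%:R - j%:R) * (x ^_ j)%:R :> rat.
  case: x => [|x]; first by rewrite mul0r ffact0n; case: j => [|j]; rewrite ?subrr ?mul0r ?mulr0.
  rewrite -natrM /= -ffactSS ffactnSr mulnC.
  case: (leqP j x.+1) => [jx|xj]; first by rewrite natrM natrB.
  by rewrite ffact_small // muln0 mulr0.
pose A : 'M[rat]_k := \matrix_(i < k, j < k) ((l i) ^_ j)%:R.
rewrite mulrBl -[falling_det k l]/(\det A) -(sum_det_scale_row A (fun j => (j : nat)%:R)).
rewrite mulr_suml -sumrB; apply: eq_bigr => i _.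
pose C : 'M[rat]_k := \matrix_(p, q) (if p == i then (q : nat)%:R * A p q else A p q).
have -> : \det C = (l i)%:R * \det A + - (l i)%:R * falling_det k (lower_col l i).
  apply: (@determinant_multilinear _ _ _ _ _ i).
  - apply/rowP=> q; rewrite !mxE eqxx /lower_col eqxx.
    by rewrite mulNr Ff; ring.
  - by apply/matrixP=> p q; rewrite !mxE eq_sym (negPf (neq_lift _ _)).
  - apply/matrixP=> p q; rewrite !mxE /lower_col -val_eqE /=.
    by rewrite !(eq_sym _ (i : nat)) (negPf (neq_bump _ _)).
by ring.
Qed.

Lemma falling_det_staircase k : falling_det k id = (\prod_(i < k) i`!)%:R.
Proof.
rewrite /falling_det det_trig.
  by rewrite natr_prod; apply: eq_bigr => i _; rewrite mxE ffactnn.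
by apply/is_trig_mxP=> i j ij; rewrite mxE ffact_small.
Qed.

Definition falling_poly (j : nat) : {poly rat} := \prod_(i < j) ('X - (i : nat)%:R%:P).

Lemma falling_polyE j (x : nat) : (falling_poly j).[x%:R] = (x ^_ j)%:R.
Proof.
rewrite /falling_poly; elim: j => [|j IHj].
  by rewrite big_ord0 hornerE.
rewrite big_ord_recr /= hornerM IHj hornerXsubC ffactnSr.
case: (leqP j x) => [jx|xj]; first by rewrite natrM natrB.
by rewrite ffact_small // mul0r.
Qed.

Definition diffprod (k : nat) (x : nat -> rat) : rat :=
  \prod_(j < k) \prod_(i < j) (x j - x i).

Lemma diffprodS k x : diffprod k.+1 x = diffprod k x * \prod_(i < k) (x k - x i).
Proof. by rewrite /diffprod big_ord_recr. Qed.

(** Falling factorials are monic polynomials of consecutive degrees, so their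
   determinant differs from that of Vandermonde by a unitriangular factor. *)
Lemma falling_detE k l : falling_det k l = diffprod k (fun i => (l i)%:R).
Proof.
pose a : 'rV[rat]_k := \row_i (l i)%:R.
pose C : 'M[rat]_k := \matrix_(j, i) (falling_poly j)`_i.
have szq j : size (falling_poly j) = j.+1.
  by rewrite /falling_poly size_prod_XsubC /index_enum -enumT size_enum_ord.
have -> : falling_det k l = \det (C *m Vandermonde k a).
  rewrite /falling_det -det_tr; congr (\det _); apply/matrixP=> j i; rewrite !mxE.
  rewrite -falling_polyE horner_coef szq.
  rewrite (big_ord_widen k (fun p => (falling_poly j)`_p * (l i)%:R ^+ p)) //.
  rewrite big_mkcond; apply: eq_bigr => p _; rewrite !mxE.
  by case: ltnP => // jp; rewrite nth_default ?szq ?mul0r.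
rewrite det_mulmx det_Vandermonde det_trig; last first.
  by apply/is_trig_mxP=> j i ji; rewrite mxE nth_default // szq.
rewrite big1 ?mul1r => [|j _]; last first.
  have := monic_prod_XsubC (index_enum 'I_j) xpredT (fun i : 'I_j => (i : nat)%:R : rat).
  by rewrite mxE -/(falling_poly j) monicE lead_coefE szq => /eqP.
rewrite (exchange_big_dep predT) //=; apply: eq_bigr => j _.
rewrite (big_ord_widen k (fun i => (l j)%:R - (l i)%:R)) ?(ltnW (ltn_ord j)) //.
by apply: eq_bigr => i _; rewrite !mxE.
Qed.

(** Both sides satisfy the same recursion in the number of cells. The sum in
   falling_det_step runs over all columns, but the term of a column that is not
   removable vanishes: either l_j = 0, or lowering l_j makes it equal to
   l_(j-1). *)
Lemma frame_formula m n h : (forall i j, (i <= j < m)%N -> (h i <= h j)%N) ->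
  (num_syt (col_shape m n h))%:R * (\prod_(j < m) (h j + j)`!)%:R
  = ((\sum_(j < m) h j)`!)%:R * falling_det m (fun j => h j + j)%N.
Proof.
move Es: (\sum_(j < m) h j)%N => s.
elim: s h Es => [|s IHs] h Es h_nd.
  have h0 j : (j < m)%N -> h j = 0%N.
    move=> jm; move/eqP: Es; rewrite sum_nat_eq0 => /forallP/(_ (Ordinal jm)).
    by move/eqP.
  have -> : col_shape m n h = fset0.
    apply/fsetP=> x; rewrite in_fset0; apply/negP=> /col_shapeP[j [i [jm]]].
    by rewrite h0.
  rewrite num_syt_fset0 !mul1r (@eq_falling_det _ _ id).
    by rewrite falling_det_staircase; congr _%:R; apply: eq_bigr => j _; rewrite h0.
  by move=> j jm; rewrite h0.
have step (j : 'I_m) : (0 < h j)%N ->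
    lower_col (fun i => h i + i)%N j =1 (fun i => lower_col h j i + i)%N.
  by move=> hj i; rewrite /lower_col; case: eqP => // ->; lia.
have -> : s.+1`!%:R * falling_det m (fun j => h j + j)%N
   = s`!%:R * \sum_(j < m) (h j + j)%:R * falling_det m (lower_col (fun i => h i + i)%N j).
  rewrite falling_det_step -sumrB; under eq_bigr do rewrite natrD addrK.
  by rewrite -natr_sum Es factS natrM; ring.
rewrite num_syt_col_shape ?Es // natr_sum mulr_suml mulr_sumr.
rewrite big_mkcond; apply: eq_bigr => j _.
case: ifP => [/removableP[hj hk]|].
  have Es' : (\sum_(i < m) lower_col h j i = s)%N.
    apply: succn_inj; rewrite -Es (bigD1 j) //= [RHS](bigD1 j) //= /lower_col eqxx.
    rewrite -addSn prednK //; congr (_ + _)%N; apply: eq_bigr => i ij.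
    by rewrite -val_eqE in ij; rewrite (negPf ij).
  have nd' i i' : (i <= i' < m)%N -> (lower_col h j i <= lower_col h j i')%N.
    move=> ii'; have := h_nd _ _ ii'; have := hk i; move: ii'.
    rewrite /lower_col; do 2![case: eqP => [->|?]]; lia.
  have := IHs _ Es' nd'.
  rewrite -(eq_falling_det (fun i _ => step j hj i)) => IH.
  rewrite [RHS]mulrCA -IH mulrCA; congr (_ * _).
  rewrite -natrM; congr _%:R; rewrite (bigD1 j) //= [in RHS](bigD1 j) //= mulnA.
  congr (_ * _)%N.
    by rewrite /lower_col eqxx; case: (h j) hj => // p _ /=; rewrite addSn factS.
  by apply: eq_bigr => i ij; rewrite -val_eqE in ij; rewrite /lower_col (negPf ij).
move=> nrem.
suff E0 : (h j + j)%:R * falling_det m (lower_col (fun i => h i + i)%N j) = 0.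
  by rewrite E0 mulr0.
case j0: (j == 0%N :> nat).
  suff -> : h j = 0%N by rewrite (eqP j0) mul0r.
  apply/eqP; rewrite -leqn0 leqNgt; apply/negP=> hj; case/removableP: nrem.
  by split=> // k; rewrite (eqP j0).
rewrite (@falling_det_eq0 _ _ j.-1 j) ?mulr0 //; first by have := ltn_ord j; lia.
have jm := ltn_ord j.
have lt_pj : (j.-1 < j)%N by lia.
rewrite /lower_col eqxx ltn_eqF //.
have le1 : (h j.-1 <= h j)%N by apply: h_nd; lia.
suff : ~~ (h j.-1 < h j)%N by lia.
apply/negP=> lt1; case/removableP: nrem; split; first lia.
move=> k kj; apply: leq_ltn_trans lt1; apply: h_nd; lia.
Qed.

(** * Filling the first four columns *)

(** Heights left when t, v, w cells of the first three columns are filled and b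
   added cells are still empty on top of the fourth column. *)
Definition state_height (n b t v w j : nat) : nat :=
  match j with
  | 0 => n - t | 1 => n - v | 2 => n - w | 3 => n + b | _ => n
  end.

(** Extended by 0 to all indices, so that sums may range over a full box. *)
Definition state_count (m n b t v w : nat) : rat :=
  if (w <= v <= t)%N && (t <= n)%N
  then (num_syt (col_shape m n (state_height n b t v w)))%:R else 0.

(** The columns to the right of the fourth one are blocked, since b.+1 > 0
   makes the fourth column strictly higher than they are. *)
Lemma state_count_rec m n b t v w : (3 < m)%N -> (w <= v <= t)%N -> (t <= n)%N ->
  state_count m n b.+1 t v w
  = state_count m n b t v w + state_count m n b.+1 t.+1 v w
    + state_count m n b.+1 t v.+1 w + state_count m n b.+1 t v w.+1.
Proof.
move=> m3 wvt tn; rewrite /state_count wvt tn /=.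
rewrite num_syt_col_shape; last by rewrite (bigD1 (Ordinal m3)) //= addnS.
set h := state_height n b.+1 t v w.
rewrite -(big_mkord (removable h) (fun j => num_syt (col_shape m n (lower_col h j)))).
rewrite (@big_cat_nat _ _ _ 4) //= [X in (_ + X)%N]big_nat_cond.
rewrite [X in (_ + X)%N]big1 ?addn0; last first.
  move=> j /andP[/andP[j4 _]] /removableP[_ hj]; move: {hj}(hj 3%N j4).
  by rewrite /h; case: j j4 => [|[|[|[|j]]]] //=; lia.
rewrite big_mkcond 4?big_nat_recr //= big_geq // add0n.
have R0 : removable h 0 = (t < n)%N.
  by apply/removableP/idP => /= [[]|]; [|split=> //]; lia.
have R1 : removable h 1 = (v < t)%N.
  apply/removableP/idP => [[_ /(_ 0%N isT)] /=|vt]; first lia.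
  by split=> [|[|k]] //=; lia.
have R2 : removable h 2 = (w < v)%N.
  apply/removableP/idP => [[_ /(_ 1%N isT)] /=|vt]; first lia.
  by split=> [|[|[|k]]] //=; lia.
have R3 : removable h 3 = true.
  by apply/removableP; split=> [|[|[|[|k]]]] //=; lia.
have E0 : col_shape m n (lower_col h 0) = col_shape m n (state_height n b.+1 t.+1 v w).
  by apply: eq_col_shape => -[|[|[|[|j]]]] _ //=; rewrite /lower_col /=; lia.
have E1 : col_shape m n (lower_col h 1) = col_shape m n (state_height n b.+1 t v.+1 w).
  by apply: eq_col_shape => -[|[|[|[|j]]]] _ //=; rewrite /lower_col /=; lia.
have E2 : col_shape m n (lower_col h 2) = col_shape m n (state_height n b.+1 t v w.+1).
  by apply: eq_col_shape => -[|[|[|[|j]]]] _ //=; rewrite /lower_col /=; lia.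
have E3 : col_shape m n (lower_col h 3) = col_shape m n (state_height n b t v w).
  by apply: eq_col_shape => -[|[|[|[|j]]]] _ //=; rewrite /lower_col /=; lia.
rewrite R0 R1 R2 R3 E0 E1 E2 E3.
have -> : ((w <= v <= t.+1) && (t < n))%N = (t < n)%N by lia.
have -> : ((w <= v.+1 <= t) && true)%N = (v < t)%N by lia.
have -> : ((w < v <= t) && true)%N = (w < v)%N by lia.
by do 3![case: ifP => _]; rewrite !natrD; ring.
Qed.

(** The number of standard Young tableaux with columns of lengths t >= v >= w,
   by the hook length formula; this meaning enters through the value 1 for the
   empty shape and the recursion below. *)
Definition three_col_count (t v w : nat) : rat :=
  (t + v + w)`!%:R * ((t%:R - v%:R + 1) * (t%:R - w%:R + 2) * (v%:R - w%:R + 1))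
  / (t.+2`!%:R * v.+1`!%:R * w`!%:R).

Lemma fact_neq0 (x : nat) : x`!%:R != 0 :> rat.
Proof. by rewrite pnatr_eq0 -lt0n fact_gt0. Qed.

(** The tableaux are sorted by the column of their last cell. When removing that
   cell does not leave a partition, the factor t - v + 1 or v - w + 1 of the
   smaller shape is 0, so the term drops out. *)
Lemma three_col_count_rec t v w : (w <= v <= t)%N -> (0 < t)%N ->
  three_col_count t v w
  = (0 < t)%N%:R * three_col_count t.-1 v w + (0 < v)%N%:R * three_col_count t v.-1 w
    + (0 < w)%N%:R * three_col_count t v w.-1.
Proof.
case: t => [//|t] wvt _; rewrite /three_col_count.
case: v wvt => [|v] wvt.
  have -> : w = 0%N by lia.
  rewrite !addn0 /= !factS !natrM -!natr1.
  have := ler0n rat t; have := fact_neq0 t => *; field.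
  by do !(apply/andP; split); first [assumption | apply: lt0r_neq0; lra].
case: w wvt => [|w] wvt.
  rewrite !(addn0, addSn, addnS) /= !factS !natrM -!natr1 natrD.
  have := ler0n rat t; have := ler0n rat v.
  have := fact_neq0 t; have := fact_neq0 v => *; field.
  by do !(apply/andP; split); first [assumption | apply: lt0r_neq0; lra].
rewrite !(addn0, addSn, addnS) /= !factS !natrM -!natr1 !natrD.
have := ler0n rat t; have := ler0n rat v; have := ler0n rat w.
have := fact_neq0 t; have := fact_neq0 v; have := fact_neq0 w => *; field.
by do !(apply/andP; split); first [assumption | apply: lt0r_neq0; lra].
Qed.

(** * Summation by parts *)

Lemma state_count_invalid m n b t v w :
  ~~ ((w <= v <= t)%N && (t <= n)%N) -> state_count m n b t v w = 0.
Proof. by rewrite /state_count => /negPf->. Qed.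

(** Outside the domain of state_count_rec, either the state counts at t, v, w
   and at the three successors are 0, or v = t + 1 or w = v + 1, and then
   three_col_count is 0. *)
Lemma state_weight_rec m n b t v w : (3 < m)%N ->
  three_col_count t v w * state_count m n b t v w
  = three_col_count t v w *
    (state_count m n b.+1 t v w - state_count m n b.+1 t.+1 v w
    - state_count m n b.+1 t v.+1 w - state_count m n b.+1 t v w.+1).
Proof.
move=> m3; case: (boolP ((w <= v <= t)%N && (t <= n)%N)) => [/andP[wvt tn]|inv].
  by rewrite [state_count m n b.+1 t v w]state_count_rec //; ring.
case: (boolP ((v == t.+1) || (w == v.+1))) => [border|nborder].
  suff -> : three_col_count t v w = 0 by rewrite !mul0r.
  rewrite /three_col_count.
  by case/orP: border => /eqP->; rewrite -natr1; ring.
by rewrite !state_count_invalid; [ring|lia..].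
Qed.

Definition box_sum (n : nat) (f : nat -> nat -> nat -> rat) : rat :=
  \sum_(t < n.+1) \sum_(v < n.+1) \sum_(w < n.+1) f t v w.

Lemma eq_box_sum n f g :
  (forall t v w, f t v w = g t v w) -> box_sum n f = box_sum n g.
Proof. by move=> E; do 3!apply: eq_bigr => ? _. Qed.

Lemma box_sumB n f g :
  box_sum n (fun t v w => f t v w - g t v w) = box_sum n f - box_sum n g.
Proof. by rewrite /box_sum -sumrB; do 2![apply: eq_bigr => ? _; rewrite -sumrB]. Qed.

Lemma sum_shift n (g : nat -> rat) : g n.+1 = 0 ->
  \sum_(i < n.+1) g i.+1 = \sum_(i < n.+1) (0 < i)%N%:R * g i.
Proof.
move=> gn; rewrite big_ord_recr /= gn addr0 [RHS]big_ord_recl mul0r add0r.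
by apply: eq_bigr => i _; rewrite mul1r.
Qed.

Lemma box_sum_shift1 n g : (forall v w, g n.+1 v w = 0) ->
  box_sum n (fun t v w => g t.+1 v w) = box_sum n (fun t v w => (0 < t)%N%:R * g t v w).
Proof.
move=> gn; rewrite /box_sum (@sum_shift n (fun t => \sum_(v < n.+1) \sum_(w < n.+1) g t v w)).
  by apply: eq_bigr => t _; rewrite mulr_sumr; apply: eq_bigr => v _; rewrite mulr_sumr.
by rewrite big1 // => v _; rewrite big1.
Qed.

Lemma box_sum_shift2 n g : (forall t w, (t <= n)%N -> g t n.+1 w = 0) ->
  box_sum n (fun t v w => g t v.+1 w) = box_sum n (fun t v w => (0 < v)%N%:R * g t v w).
Proof.
move=> gn; apply: eq_bigr => t _; rewrite (@sum_shift n (fun v => \sum_(w < n.+1) g t v w)).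
  by apply: eq_bigr => v _; rewrite mulr_sumr.
by rewrite big1 // => w _; rewrite gn // -ltnS.
Qed.

Lemma box_sum_shift3 n g : (forall t v, (v <= n)%N -> g t v n.+1 = 0) ->
  box_sum n (fun t v w => g t v w.+1) = box_sum n (fun t v w => (0 < w)%N%:R * g t v w).
Proof.
move=> gn; apply: eq_bigr => t _; apply: eq_bigr => v _.
by rewrite (@sum_shift n (g t v)) // gn // -ltnS.
Qed.

Definition weighted_count m n b (c : nat -> rat) : rat :=
  box_sum n (fun t v w => c (t + v + w)%N * three_col_count t v w * state_count m n b t v w).

(** Summation by parts: state_weight_rec expresses the count for b through those
   for b.+1, shifting the indices moves the differences onto
   c (t + v + w) * three_col_count t v w, and three_col_count_rec leaves the
   difference of c. *)
Lemma weighted_count_step m n b (c d : nat -> rat) : (3 < m)%N ->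
  d 0%N = c 0%N -> (forall s, d s.+1 = c s.+1 - c s) ->
  weighted_count m n b.+1 d = weighted_count m n b c.
Proof.
move=> m3 d0 dS; pose F := three_col_count; pose G := state_count m n b.+1.
pose g1 t v w := c (t.-1 + v + w)%N * F t.-1 v w * G t v w.
pose g2 t v w := c (t + v.-1 + w)%N * F t v.-1 w * G t v w.
pose g3 t v w := c (t + v + w.-1)%N * F t v w.-1 * G t v w.
transitivity (box_sum n (fun t v w => c (t + v + w)%N * F t v w * G t v w)
   - box_sum n (fun t v w => g1 t.+1 v w) - box_sum n (fun t v w => g2 t v.+1 w)
   - box_sum n (fun t v w => g3 t v w.+1)).
  rewrite box_sum_shift1; last first.
    by move=> v w; rewrite /g1 /G state_count_invalid ?mulr0 //; lia.
  rewrite box_sum_shift2; last first.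
    by move=> t w tn; rewrite /g2 /G state_count_invalid ?mulr0 //; lia.
  rewrite box_sum_shift3; last first.
    by move=> t v vn; rewrite /g3 /G state_count_invalid ?mulr0 //; lia.
  rewrite -!box_sumB; apply: eq_box_sum => t v w; rewrite /g1 /g2 /g3 -/G -/F.
  case: (boolP ((w <= v <= t)%N && (t <= n)%N)) => [/andP[wvt tn]|inv]; last first.
    by rewrite /G state_count_invalid //; ring.
  case: (posnP t) => [t0|tpos].
    have -> : v = 0%N by lia.
    have -> : w = 0%N by lia.
    by rewrite t0 !mul0r !subr0 d0.
  have Ft : F t v w = (0 < t)%N%:R * F t.-1 v w + (0 < v)%N%:R * F t v.-1 w
                      + (0 < w)%N%:R * F t v w.-1 by apply: three_col_count_rec.
  have [s Es] : exists s, (t + v + w)%N = s.+1 by exists (t + v + w).-1; lia.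
  rewrite Es dS.
  have -> : (t.-1 + v + w)%N = s by lia.
  have E2 : (0 < v)%N%:R * (c (t + v.-1 + w)%N * F t v.-1 w * G t v w)
         = (0 < v)%N%:R * (c s * F t v.-1 w * G t v w).
    case: (posnP v) => [_|vp]; first by rewrite !mul0r.
    by have -> : (t + v.-1 + w)%N = s by lia.
  have E3 : (0 < w)%N%:R * (c (t + v + w.-1)%N * F t v w.-1 * G t v w)
         = (0 < w)%N%:R * (c s * F t v w.-1 * G t v w).
    case: (posnP w) => [_|vp]; first by rewrite !mul0r.
    by have -> : (t + v + w.-1)%N = s by lia.
  by rewrite E2 E3 Ft tpos; ring.
rewrite -!box_sumB; apply: eq_box_sum => t v w; rewrite /g1 /g2 /g3 /=.
by rewrite -[RHS]mulrA state_weight_rec // -/F /G; ring.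
Qed.

(** The coefficient 'C(s.-1, s) is 1 at s = 0 and 0 elsewhere; partial sums of
   'C((r + s).-1, s) over s are 'C(r + s, s), by Pascal's rule. *)
Lemma weighted_count_bin m n r b : (3 < m)%N ->
  weighted_count m n (r + b) (fun s => 'C(s.-1, s)%:R)
  = weighted_count m n b (fun s => 'C((r + s).-1, s)%:R).
Proof.
move=> m3; elim: r b => [|r IHr] b //.
rewrite addSnnS IHr; apply: weighted_count_step => // [|s]; first by rewrite !bin0.
by rewrite addnS !addSn /= addnS binS natrD addrK.
Qed.

Lemma weighted_count_init m n b :
  weighted_count m n b (fun s => 'C(s.-1, s)%:R) = state_count m n b 0 0 0.
Proof.
have F0 : three_col_count 0 0 0 = 1.
  by rewrite /three_col_count (_ : 2`! = 2%N) // (_ : 1`! = 1%N) // fact0; field.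
have C0 s : (0 < s)%N -> 'C(s.-1, s)%:R = 0 :> rat by move=> sp; rewrite bin_small ?prednK.
rewrite /weighted_count /box_sum (bigD1 ord0) //= (bigD1 ord0) //= (bigD1 ord0) //=.
rewrite bin0 F0 !mul1r !big1 ?addr0 // => i i0.
all: try (rewrite big1 // => ? _); try (rewrite big1 // => ? _).
all: by rewrite C0 ?mul0r //; move: i0; rewrite -val_eqE /=; lia.
Qed.

Lemma battery_count m n a : (3 < m)%N ->
  (num_syt (battery m n a 4))%:R
  = \sum_(t < n.+1) \sum_(v < t.+1) \sum_(w < v.+1)
      'C((a + (t + v + w)).-1, t + v + w)%:R * three_col_count t v w
      * (num_syt (col_shape m n (state_height n 0 t v w)))%:R.
Proof.
move=> m3; rewrite battery_col_shape //.
transitivity (state_count m n a 0 0 0).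
  rewrite /state_count /=; congr (num_syt _)%:R; apply: eq_col_shape.
  by move=> [|[|[|[|j]]]] _ //=; rewrite subn0.
rewrite -weighted_count_init -[a in LHS]addn0 weighted_count_bin //.
rewrite /weighted_count /box_sum; apply: eq_bigr => t _.
have tn : (t <= n)%N by rewrite -ltnS.
pose f v w := 'C((a + (t + v + w)).-1, t + v + w)%:R * three_col_count t v w
      * (num_syt (col_shape m n (state_height n 0 t v w)))%:R.
rewrite (big_ord_widen n.+1 (fun v => \sum_(w < v.+1) f v w)) //.
rewrite [RHS]big_mkcond; apply: eq_bigr => v _.
case: ltnP => vt; last first.
  by rewrite big1 // => w _; rewrite state_count_invalid ?mulr0 //; lia.
rewrite (big_ord_widen n.+1 (f v)) ?(leq_trans vt) //.
rewrite [RHS]big_mkcond; apply: eq_bigr => w _.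
case: ltnP => wv; last by rewrite state_count_invalid ?mulr0 //; lia.
by rewrite /state_count ifT //; lia.
Qed.

(** * Comparison with the hypergeometric series *)

Lemma poch_recr x s : poch x s.+1 = poch x s * (x + s%:R).
Proof. by rewrite /poch big_ord_recr. Qed.

Lemma poch_add x s r : poch x (s + r) = poch x s * poch (x + s%:R) r.
Proof.
elim: r => [|r IHr]; first by rewrite addn0 /poch big_ord0 mulr1.
by rewrite addnS !poch_recr IHr natrD; ring.
Qed.

(** Both sides are x (x + 1) ... (x + s). *)
Lemma poch_shift x s : poch (x + 1) s * x = poch x s * (x + s%:R).
Proof.
elim: s => [|s IHs]; first by rewrite /poch !big_ord0; ring.
by rewrite !poch_recr mulrAC IHs -natr1; ring.
Qed.

Lemma poch_fact (x s : nat) : poch x.+1%:R s * x`!%:R = (x + s)`!%:R.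
Proof.
elim: s => [|s IHs]; first by rewrite /poch big_ord0 mul1r addn0.
by rewrite poch_recr mulrAC IHs addnS factS natrM -!natr1 natrD; ring.
Qed.

Lemma poch_opp_fact (x s : nat) : (s <= x)%N ->
  poch (- x%:R) s * (x - s)`!%:R = (-1) ^+ s * x`!%:R.
Proof.
elim: s => [|s IHs] sx; first by rewrite /poch big_ord0 subn0 expr0.
rewrite poch_recr exprS mulN1r mulNr -(IHs (ltnW sx)) -(subnSK sx) factS natrM.
by rewrite subnSK // natrB ?(ltnW sx) //; ring.
Qed.

Lemma poch_neq0 x s : (forall i, (i < s)%N -> x + i%:R != 0) -> poch x s != 0.
Proof. by move=> nz; apply/prodf_neq0 => i _; apply: nz. Qed.

Lemma poch_opp_neq0 (x s : nat) : (s <= x)%N -> poch (- x%:R) s != 0.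
Proof.
move=> sx; apply: poch_neq0 => i i_s.
by rewrite addrC subr_eq0 eqr_nat ltn_eqF // (leq_trans i_s).
Qed.

Lemma poch1 s : poch 1 s = s`!%:R.
Proof. by have := poch_fact 0 s; rewrite mulr1 add0n. Qed.

Lemma big_ord_3 (T : Type) (idx : T) (op : Monoid.com_law idx) k (f : nat -> T) :
  \big[op/idx]_(j < k.+3) f j
  = op (op (op (f 0%N) (f 1%N)) (f 2%N)) (\big[op/idx]_(j < k) f j.+3).
Proof. by rewrite !big_ord_recl !Monoid.mulmA. Qed.

(** The numbers l_j = h_j + j of frame_formula for the full rectangle and for
   the rectangle with t, v, w cells removed from its first three columns. *)
Definition rect_level (n j : nat) : rat := (n + j)%:R.

Definition state_level (n t v w j : nat) : rat :=
  (state_height n 0 t v w j + j)%:R.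

(** Only pairs of indices with a member below 3 change. In the induction on the
   number of further columns, the new column contributes k + 3 + t, k + 2 + v,
   k + 1 + w in place of k + 3, k + 2, k + 1, which extends the factorials. *)
Lemma diffprod_state n k t v w : (w <= v <= t)%N -> (t <= n)%N ->
  diffprod k.+3 (state_level n t v w)
    * (t.+2`!%:R * v.+1`!%:R * w`!%:R) * (k.+2`!%:R * k.+1`!%:R * k`!%:R)
  = diffprod k.+3 (rect_level n)
    * ((t%:R - v%:R + 1) * (t%:R - w%:R + 2) * (v%:R - w%:R + 1))
    * ((k.+2 + t)`!%:R * (k.+1 + v)`!%:R * (k + w)`!%:R).
Proof.
move=> wvt tn.
have L0 : state_level n t v w 0 = n%:R - t%:R.
  by rewrite /state_level /= addn0 natrB.
have L1 : state_level n t v w 1 = n%:R - v%:R + 1.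
  rewrite /state_level /= natrD natrB //; lia.
have L2 : state_level n t v w 2 = n%:R - w%:R + 2.
  rewrite /state_level /= natrD natrB //; lia.
have L3 j : state_level n t v w j.+3 = rect_level n j.+3.
  by rewrite /state_level; case: j => //=; rewrite addn0.
elim: k => [|k IHk].
  rewrite !diffprodS /diffprod big_ord0 !big_ord_recr !big_ord0 /= L0 L1 L2.
  rewrite !addSn !add0n (_ : 2`! = 2%N) // (_ : 1`! = 1%N) // fact0.
  by rewrite /rect_level addn0 !natrD; ring.
rewrite diffprodS [diffprod k.+4 (rect_level n)]diffprodS.
rewrite (big_ord_3 _ k (fun i => state_level n t v w k.+3 - state_level n t v w i)).
rewrite (big_ord_3 _ k (fun i => rect_level n k.+3 - rect_level n i)) L3 L0 L1 L2.
under eq_bigr do rewrite L3.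
set P := (\prod_(i < k) _).
have step x y z : (k.+3 + x)`!%:R * (k.+2 + y)`!%:R * (k.+1 + z)`!%:R
   = ((k + x)%:R + 3) * ((k + y)%:R + 2) * ((k + z)%:R + 1) *
     ((k.+2 + x)`!%:R * (k.+1 + y)`!%:R * (k + z)`!%:R) :> rat.
  rewrite !addSn [(k + x).+3`!]factS [(k + y).+2`!]factS [(k + z).+1`!]factS !natrM.
  by rewrite -!natr1; ring.
have := step 0 0 0; rewrite !addn0 => ->; rewrite step.
have R0 : rect_level n 0 = n%:R by rewrite /rect_level addn0.
have R1 : rect_level n 1 = n%:R + 1 by rewrite /rect_level natrD.
have R2 : rect_level n 2 = n%:R + 2 by rewrite /rect_level natrD.
have Rk : rect_level n k.+3 = n%:R + k%:R + 3.
  by rewrite /rect_level -(addn3 k) !natrD addrA.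
rewrite /= R0 R1 R2 Rk !(natrD _ k).
set c := (k%:R + 3) * _ * _; set A := _ * P.
rewrite [LHS](_ : _ = A * c * (diffprod k.+3 (state_level n t v w)
    * (t.+2`!%:R * v.+1`!%:R * w`!%:R) * (k.+2`!%:R * k.+1`!%:R * k`!%:R))); last by ring.
by rewrite IHk /A /c; ring.
Qed.

Lemma prod_height_fact n k t v w : (w <= v <= t)%N -> (t <= n)%N ->
  (\prod_(j < k.+3) (state_height n 0 t v w j + j)`!)%N
  = ((n - t)`! * (n.+1 - v)`! * (n.+2 - w)`! * \prod_(j < k) (n + j.+3)`!)%N.
Proof.
move=> wvt tn; rewrite (big_ord_3 _ k (fun j => (state_height n 0 t v w j + j)`!)) /=.
have -> : (n.+1 - v)%N = (n - v + 1)%N by lia.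
have -> : (n.+2 - w)%N = (n - w + 2)%N by lia.
rewrite addn0; congr (_ * _)%N.
by apply: eq_bigr => -[[|j] jk] _ //=; rewrite addn0.
Qed.

Lemma sum_height n k t v w : (w <= v <= t)%N -> (t <= n)%N ->
  (\sum_(j < k.+3) state_height n 0 t v w j = k.+3 * n - (t + v + w))%N.
Proof.
move=> wvt tn; rewrite (big_ord_3 _ k (state_height n 0 t v w)) /=.
rewrite (eq_bigr (fun=> n)); last by move=> [[|j] jk] _ //=; rewrite addn0.
by rewrite sum_nat_const card_ord; lia.
Qed.

Lemma state_frame n k t v w : (w <= v <= t)%N -> (t <= n)%N ->
  (num_syt (col_shape k.+3 n (state_height n 0 t v w)))%:R
    * ((n - t)`!%:R * (n.+1 - v)`!%:R * (n.+2 - w)`!%:R * (\prod_(j < k) (n + j.+3)`!)%:R)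
  = (k.+3 * n - (t + v + w))`!%:R * diffprod k.+3 (state_level n t v w) :> rat.
Proof.
move=> wvt tn.
rewrite -!natrM -(prod_height_fact _ wvt tn) natrM frame_formula; last first.
  by move=> [|[|[|[|i]]]] [|[|[|[|j]]]] //=; lia.
by rewrite sum_height // falling_detE.
Qed.

Lemma diffprod_rect_neq0 n k : diffprod k (rect_level n) != 0.
Proof.
apply/prodf_neq0 => j _; apply/prodf_neq0 => i _.
by rewrite /rect_level subr_eq0 eqr_nat eqn_add2l neq_ltn ltn_ord orbT.
Qed.

(** Quotient of frame_formula for the two shapes: the factorials of the levels
   give the Pochhammer symbols in n, the Vandermonde products those in m. *)
Lemma state_ratio m n t v w : (3 < m)%N -> (w <= v <= t)%N -> (t <= n)%N ->
  (num_syt (col_shape m n (state_height n 0 t v w)))%:R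
    * poch (- (m * n)%:R) (t + v + w) * (t.+2`!%:R * v.+1`!%:R * w`!%:R)
  = (num_syt (rect m n))%:R * ((t%:R - v%:R + 1) * (t%:R - w%:R + 2) * (v%:R - w%:R + 1))
    * (poch (- n%:R) t * poch (- n.+1%:R) v * poch (- n.+2%:R) w)
    * (poch m%:R t * poch m.-1%:R v * poch m.-2%:R w).
Proof.
case: m => [|[|[|k]]] //= kpos wvt tn.
have -> : rect k.+3 n = col_shape k.+3 n (state_height n 0 0 0 0).
  rewrite rect_col_shape; apply: eq_col_shape => -[|[|[|[|j]]]] _ //=; lia.
have s_le : (t + v + w <= k.+3 * n)%N by nia.
have := @state_frame n k 0 0 0 isT isT; have := state_frame k wvt tn.
have := diffprod_state k wvt tn; have := diffprod_rect_neq0 n k.+3.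
have -> : diffprod k.+3 (state_level n 0 0 0) = diffprod k.+3 (rect_level n).
  have L j : state_level n 0 0 0 j = rect_level n j.
    by rewrite /state_level /rect_level; case: j => [|[|[|[|j]]]] /=; rewrite ?subn0 ?addn0.
  by apply: eq_bigr => j _; apply: eq_bigr => i _; rewrite !L.
rewrite !subn0.
have pmn := poch_opp_fact s_le; have pt := poch_opp_fact tn.
have vn : (v <= n.+1)%N by lia.
have wn : (w <= n.+2)%N by lia.
have pv := poch_opp_fact vn; have pw := poch_opp_fact wn.
have qt := poch_fact k.+2 t; have qv := poch_fact k.+1 v; have qw := poch_fact k w.
rewrite !exprD in pmn.
have Rnz : (\prod_(j < k) (n + j.+3)`!)%:R != 0 :> rat.
  by rewrite natr_prod; apply/prodf_neq0 => j _; apply: fact_neq0.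
move=> Vnz EV EN EN0.
rewrite (canRL (mulfK (fact_neq0 _)) pmn) (canRL (mulfK (fact_neq0 _)) pt).
rewrite (canRL (mulfK (fact_neq0 _)) pv) (canRL (mulfK (fact_neq0 _)) pw).
rewrite (canRL (mulfK (fact_neq0 _)) qt) (canRL (mulfK (fact_neq0 _)) qv).
rewrite (canRL (mulfK (fact_neq0 _)) qw).
have nz3 x y z : x`!%:R * y`!%:R * z`!%:R != 0 :> rat by rewrite !mulf_neq0 ?fact_neq0.
rewrite (canRL (mulfK (mulf_neq0 (nz3 _ _ _) Rnz)) EN).
rewrite (canRL (mulfK (mulf_neq0 (nz3 _ _ _) Rnz)) EN0).
rewrite (canRL (mulfK (nz3 _ _ _)) (canRL (mulfK (nz3 _ _ _)) EV)).
by field; rewrite !fact_neq0 Rnz.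
Qed.

(** This explains the squared quotients of the series: up to constants they are
   the factors t - v + 1, t - w + 2, v - w + 1 of three_col_count, one copy
   coming from three_col_count and the other from state_ratio. *)
Lemma poch_opp_ratio (x : rat) s : 0 <= x ->
  poch (- x) s = poch (- x - 1) s * ((x + 1 - s%:R) / (x + 1)).
Proof.
move=> x0; have nz : x + 1 != 0 by apply: lt0r_neq0; lra.
apply: (mulIf nz); rewrite -!mulrA mulVf // mulr1.
apply: oppr_inj; rewrite -!mulrN.
have -> : - (x + 1) = - x - 1 by ring.
have -> : - (x + 1 - s%:R) = - x - 1 + s%:R by ring.
by rewrite -poch_shift subrK.
Qed.

Lemma hyper_term m n a t v w : (3 < m)%N -> (0 < a)%N ->
  (w <= v <= t)%N -> (t <= n)%N ->
  'C((a + (t + v + w)).-1, t + v + w)%:R * three_col_count t v w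
    * (num_syt (col_shape m n (state_height n 0 t v w)))%:R
  = (num_syt (rect m n))%:R *
      ((poch a%:R t * poch m%:R t * poch (- n%:R) t
         / (poch (- (m%:R * n%:R)) t * poch 1 t * t`!%:R))
      * (poch (a%:R + t%:R) v * poch (m%:R - 1) v * poch (- n%:R - 1) v
           * poch (- t%:R) v ^+ 2
         / (poch (- (m%:R * n%:R) + t%:R) v * poch (- t%:R - 1) v ^+ 2
              * poch 1 v * v`!%:R))
      * (poch (a%:R + t%:R + v%:R) w * poch (m%:R - 2) w * poch (- n%:R - 2) w
           * poch (- t%:R - 1) w ^+ 2 * poch (- v%:R) w ^+ 2
         / (poch (- (m%:R * n%:R) + t%:R + v%:R) w * poch (- t%:R - 2) w ^+ 2
              * poch (- v%:R - 1) w ^+ 2 * poch 1 w * w`!%:R))).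
Proof.
move=> m3 a0 wvt tn.
have split3 x : poch x (t + v + w)
    = poch x t * poch (x + t%:R) v * poch (x + t%:R + v%:R) w.
  by rewrite !poch_add natrD addrA.
have EC : 'C((a + (t + v + w)).-1, t + v + w)%:R
    = poch a%:R (t + v + w) / (t + v + w)`!%:R :> rat.
  apply: (canRL (mulfK (fact_neq0 _))).
  case: a a0 => // a _; rewrite addSn /=.
  apply: (mulIf (fact_neq0 a)); rewrite poch_fact -!natrM -mulnA; congr _%:R.
  by rewrite -[in RHS](bin_fact (leq_addl a (t + v + w))) addnK.
have s_le : (t + v + w <= m * n)%N by nia.
have EN := state_ratio m3 wvt tn.
have Unz : t.+2`!%:R * v.+1`!%:R * w`!%:R != 0 :> rat by rewrite !mulf_neq0 ?fact_neq0.
rewrite EC (canRL (mulfK (poch_opp_neq0 s_le)) (canRL (mulfK Unz) EN)) natrM.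
rewrite (poch_opp_ratio v (ler0n _ t)) (poch_opp_ratio w (ler0n _ v)).
have -> : poch (- t%:R - 1) w
    = poch (- t%:R - 2) w * ((t%:R + 2 - w%:R) / (t%:R + 2)) :> rat.
  have := poch_opp_ratio w (ler0n rat t.+1).
  rewrite -natr1 => E; rewrite -[- t%:R - 2]/(- t%:R - (1 + 1)).
  have -> : - t%:R - 1 = - (t%:R + 1) :> rat by ring.
  rewrite E; congr (poch _ w * (_ / _)); ring.
have poch_nz x y : (y <= x)%N -> poch (- x%:R - 1) y != 0.
  move=> yx; have -> : - x%:R - 1 = - x.+1%:R :> rat by rewrite -natr1; ring.
  by apply: poch_opp_neq0; lia.
have p1 : poch (- t%:R - 1) v != 0 by apply: poch_nz; lia.
have p2 : poch (- v%:R - 1) w != 0 by apply: poch_nz; lia.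
have p3 : poch (- t%:R - 2) w != 0.
  have -> : - t%:R - 2 = - t.+1%:R - 1 :> rat by rewrite -natr1; ring.
  by apply: poch_nz; lia.
have : poch (- (m%:R * n%:R)) (t + v + w) != 0 by rewrite -natrM poch_opp_neq0.
rewrite /three_col_count !split3 !poch1 !mulf_eq0 !negb_or => /andP[/andP[p4 p5] p6].
have -> : - n.+1%:R = - n%:R - 1 :> rat by rewrite -natr1; ring.
have -> : - n.+2%:R = - n%:R - 2 :> rat by rewrite -!natr1; ring.
have -> : m.-1%:R = m%:R - 1 :> rat by rewrite -subn1 natrB //; lia.
have -> : m.-2%:R = m%:R - 2 :> rat by rewrite -subn2 natrB //; lia.
rewrite !factS !natrM -!natr1.
have := ler0n rat t; have := ler0n rat v => v0 t0.
have := fact_neq0 t; have := fact_neq0 v; have := fact_neq0 w.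
have := fact_neq0 (t + v + w) => *.
field.
by do !(apply/andP; split); first [assumption | apply: lt0r_neq0; lra].
Qed.

Theorem theorem5p6 (m n a : nat) (hm : (4 <= m)%N) (hn : (0 < n)%N)
    (ha : (0 < a)%N) :
  let A : rat := a%:R in
  let M : rat := m%:R in
  let N : rat := n%:R in
  let t (ms : seq nat) : rat := (nth 0%N ms 0)%:R in
  let v (ms : seq nat) : rat := (nth 0%N ms 1)%:R in
  (num_syt (battery m n a 4))%:R
  = (num_syt (rect m n))%:R *
    multihyp n
      [:: HRow (fun=> [:: A; M; - N])
               (fun=> [:: - (M * N); 1])
               1;
          HRow (fun ms => [:: A + t ms; M - 1; - N - 1; - t ms; - t ms])
               (fun ms => [:: - (M * N) + t ms; - t ms - 1; - t ms - 1; 1])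
               1;
          HRow (fun ms => [:: A + t ms + v ms; M - 2; - N - 2;
                              - t ms - 1; - t ms - 1; - v ms; - v ms])
               (fun ms => [:: - (M * N) + t ms + v ms; - t ms - 2; - t ms - 2;
                              - v ms - 1; - v ms - 1; 1])
               1]
  /\
  (num_syt (battery m n a 4))%:R
  = (num_syt (rect m n))%:R *
    \sum_(0 <= t < n.+1) \sum_(0 <= v < t.+1) \sum_(0 <= w < v.+1)
      (poch A t * poch M t * poch (- N) t
         / (poch (- (M * N)) t * poch 1 t * t`!%:R))
      * (poch (A + t%:R) v * poch (M - 1) v * poch (- N - 1) v
           * poch (- t%:R) v ^+ 2
         / (poch (- (M * N) + t%:R) v * poch (- t%:R - 1) v ^+ 2
              * poch 1 v * v`!%:R))
      * (poch (A + t%:R + v%:R) w * poch (M - 2) w * poch (- N - 2) w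
           * poch (- t%:R - 1) w ^+ 2 * poch (- v%:R) w ^+ 2
         / (poch (- (M * N) + t%:R + v%:R) w * poch (- t%:R - 2) w ^+ 2
              * poch (- v%:R - 1) w ^+ 2 * poch 1 w * w`!%:R)).
Proof.
move=> A M N t v.
match goal with |- _ /\ ?P => have second : P end.
  rewrite battery_count // big_mkord mulr_sumr; apply: eq_bigr => i _.
  rewrite big_mkord mulr_sumr; apply: eq_bigr => j _.
  rewrite big_mkord mulr_sumr; apply: eq_bigr => k _.
  rewrite /A /M /N; apply: hyper_term => //; last by rewrite -ltnS.
  by apply/andP; split; rewrite -ltnS ltn_ord.
split; last exact: second.
rewrite second; congr (_ * _). 
rewrite /multihyp /=.
apply: eq_bigr => i _; rewrite mulr_sumr; apply: eq_bigr => j _.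
rewrite !mulr_sumr; apply: eq_bigr => k _.
rewrite /hterm /= !big_cons !big_nil /t /v /= !expr1n.
by rewrite !mulr1 !div1r !expr2 !invfM; ring.
Qed.
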